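(* Let $\lambda=(\lambda_1,\dots,\lambda_\ell)$ be a partition of length $\ell$, and let $\mathbf{x}=(x_1,\dots,x_n)$ and $\mathbf{t}=(t_1,\dots,t_{\ell-1})$ be commuting indeterminates. Then the refined dual Grothendieck polynomial is the multi-Schur function $$g_\lambda(\mathbf{x};\mathbf{t})=s_\lambda\bigl(\mathbf{x},\ \mathbf{x}+(t_1),\ \mathbf{x}+(t_1,t_2),\ \dots,\ \mathbf{x}+\mathbf{t}\bigr).$$
   Context: **Refined dual Grothendieck polynomial.** A reverse plane partition of shape $\lambda$ (English convention, row 1 at the top) is a filling of the boxes of $\lambda$ with positive integers that weakly increases along rows and down columns. Let $\mathrm{RPP}^n(\lambda)$ be the set of those with all entries at most $n$. For $T\in\mathrm{RPP}^n(\lambda)$, let $a_i$ be the number of columns of $T$ containing $i$, and let $b_r$ be the number of boxes in row $r$ whose entry equals the entry in the box directly below. Then $g_\lambda(\mathbf{x};\mathbf{t}):=\sum_{T\in\mathrm{RPP}^n(\lambda)}\prod_{r}t_r^{b_r}\prod_{i}x_i^{a_i}$. **Multi-Schur functions.** For finite sequences of indeterminates $\mathbf{y}=(y_1,\dots,y_p)$ and $\mathbf{u}=(u_1,\dots,u_q)$, define $S_i(\mathbf{y}-\mathbf{u})$ by $\sum_{i\ge0}S_i(\mathbf{y}-\mathbf{u})\,v^i=\prod_{j=1}^q(1-u_jv)\prod_{j=1}^p(1-y_jv)^{-1}$, with $S_i=0$ for $i<0$; when $\mathbf{u}$ is empty write $S_i(\mathbf{y})$. For $I=(i_1,\dots,i_\ell)\in\mathbb{Z}^\ell$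 and alphabets $\mathbf{y}^{(1)}-\mathbf{u}^{(1)},\dots,\mathbf{y}^{(\ell)}-\mathbf{u}^{(\ell)}$, the multi-Schur function is $$s_I\bigl(\mathbf{y}^{(1)}-\mathbf{u}^{(1)},\dots,\mathbf{y}^{(\ell)}-\mathbf{u}^{(\ell)}\bigr)=\det\Bigl[S_{i_k+h-k}\bigl(\mathbf{y}^{(k)}-\mathbf{u}^{(k)}\bigr)\Bigr]_{1\le h,k\le\ell}.$$ In the claim $I=(\lambda_1,\dots,\lambda_\ell)$, and $\mathbf{x}+(t_1,\dots,t_{k-1})$ denotes the concatenated alphabet $(x_1,\dots,x_n,t_1,\dots,t_{k-1})$; this is the $k$-th argument. *)

(* Defs.v *)
From HB Require Import structures.
From mathcomp Require Import all_boot all_order all_algebra.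
From mathcomp Require Import mpoly.

Set Implicit Arguments.
Unset Strict Implicit.
Unset Printing Implicit Defensive.

Import Order.TTheory GRing.Theory Num.Theory.
Local Open Scope ring_scope.

(* Rows, columns and entries are all numbered from 0: the positive integer    *)
(* i.+1 is represented by i, so entries at most n are elements of 'I_n.       *)

Definition is_partition (la : seq nat) : bool :=
  sorted geq la && (0%N \notin la).

Definition box (la : seq nat) : finType :=
  {r : 'I_(size la) & 'I_(nth 0%N la r)}.

Definition brow (la : seq nat) (b : box la) : nat := tag b.
Definition bcol (la : seq nat) (b : box la) : nat := tagged b.

Definition filling (n : nat) (la : seq nat) : finType := {ffun box la -> 'I_n}.

Definition is_rpp (n : nat) (la : seq nat) (T : filling n la) : bool :=
  [forall b, forall c,
     (brow b == brow c) && (bcol b <= bcol c)%N ==> (T b <= T c)%N]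
  && [forall b, forall c,
     (bcol b == bcol c) && (brow b <= brow c)%N ==> (T b <= T c)%N].

(* The columns of a partition la are indexed by its largest part head 0 la.   *)
Definition col_count (n : nat) (la : seq nat) (T : filling n la) (i : 'I_n) :
    nat :=
  #|[set c : 'I_(head 0%N la) | [exists b, (bcol b == c) && (T b == i)]]|.

Definition eq_below_count (n : nat) (la : seq nat) (T : filling n la)
    (r : nat) : nat :=
  #|[set b | (brow b == r) &&
      [exists c, [&& brow c == r.+1, bcol c == bcol b & T c == T b]]]|.

(* The last row has no box below it, so its exponent is 0 and the variables   *)
(* t are only needed for the first (size la).-1 rows.                         *)
Definition dual_groth (R : comNzRingType) (n : nat) (la : seq nat)
    (x : n.-tuple R) (t : (size la).-1.-tuple R) : R :=
  \sum_(T : filling n la | is_rpp T)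
     (\prod_(r < (size la).-1) tnth t r ^+ eq_below_count T r) *
     (\prod_(i < n) tnth x i ^+ col_count T i).

(* Coefficient of v^i in \prod_(a <- u) (1 - a v) \prod_(b <- y) (1 - b v)^-1: *)
(* the geometric series (1 - b v)^-1 = \sum_k b^k v^k are truncated after     *)
(* v^i, which does not affect that coefficient (see sup_hn_gen below).        *)
Definition sup_hn (R : comNzRingType) (y u : seq R) (i : nat) : R :=
  (\prod_(a <- u) (1 - a *: 'X) *
   \prod_(b <- y) \sum_(k < i.+1) b ^+ k *: 'X^k : {poly R})`_i.

Definition sup_h (R : comNzRingType) (y u : seq R) (i : int) : R :=
  if i is Posz m then sup_hn y u m else 0.

Definition multi_schur (R : comNzRingType) (l : nat) (I : 'I_l -> int)
    (y u : 'I_l -> seq R) : R :=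
  \det (\matrix_(h < l, k < l)
          sup_h (y k) (u k) (I k + (h : nat)%:Z - (k : nat)%:Z)).

Lemma eq_coef_mul (R : comNzRingType) (m : nat) (p p' q q' : {poly R}) :
  (forall i, (i <= m)%N -> p`_i = p'`_i) ->
  (forall i, (i <= m)%N -> q`_i = q'`_i) ->
  forall i, (i <= m)%N -> (p * q)`_i = (p' * q')`_i.
Proof.
move=> Ep Eq i le_im; rewrite !coefM; apply: eq_bigr => j _.
have le_ji : (j <= i)%N by rewrite -ltnS.
by rewrite Ep ?Eq // (leq_trans _ le_im) // leq_subr.
Qed.

Lemma eq_coef_prod (R : comNzRingType) (m : nat) (s : seq R)
    (F G : R -> {poly R}) :
  (forall a i, (i <= m)%N -> (F a)`_i = (G a)`_i) ->
  forall i, (i <= m)%N ->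
    (\prod_(a <- s) F a)`_i = (\prod_(a <- s) G a)`_i.
Proof.
move=> EFG; elim: s => [|a s IHs] i le_im; first by rewrite !big_nil.
by rewrite !big_cons; apply: eq_coef_mul le_im; [exact: EFG | exact: IHs].
Qed.

Lemma coef_geom (R : comNzRingType) (b : R) (m i : nat) :
  (\sum_(k < m) b ^+ k *: 'X^k : {poly R})`_i = if (i < m)%N then b ^+ i else 0.
Proof. by rewrite -(poly_def m (fun k => b ^+ k)) coef_poly. Qed.

(* The defining identity                                                      *)
(*   \prod_(b <- y) (1 - b v) * \sum_i S_i(y - u) v^i = \prod_(a <- u) (1 - a v) *)
(* of formal power series, coefficientwise.                                   *)
Lemma sup_hn_gen (R : comNzRingType) (y u : seq R) (m : nat) :
  \sum_(j < m.+1) (\prod_(b <- y) (1 - b *: 'X) : {poly R})`_(m - j)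
      * sup_hn y u j
  = (\prod_(a <- u) (1 - a *: 'X) : {poly R})`_m.
Proof.
pose N : {poly R} := \prod_(a <- u) (1 - a *: 'X).
pose D : {poly R} := \prod_(b <- y) (1 - b *: 'X).
pose G k : {poly R} := \prod_(b <- y) \sum_(i < k) b ^+ i *: 'X^i.
have SE j : (j <= m)%N -> sup_hn y u j = (N * G m.+1)`_j.
  move=> le_jm; apply: (@eq_coef_mul R j) => // i le_ij.
  apply: (@eq_coef_prod R j) => // b k le_kj.
  by rewrite !coef_geom !ltnS le_kj (leq_trans le_kj).
rewrite (eq_bigr (fun j : 'I_m.+1 => D`_(m - j) * (N * G m.+1)`_j)); last first.
  by move=> j _; rewrite SE // -ltnS.
rewrite -coefMr mulrCA -big_split /= -/N -[in RHS](mulr1 N).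
apply: (@eq_coef_mul R m) => // i le_im.
rewrite [RHS](_ : _ = (\prod_(b <- y) (1 : {poly R}))`_i); last by rewrite big1_eq.
apply: (@eq_coef_prod R m) => // b k le_km.
rewrite [X in _ * X](eq_bigr (fun j : 'I_m.+1 => (b *: 'X) ^+ j)); last first.
  by move=> j _; rewrite exprZn.
rewrite -[1 - _]opprB mulNr -subrX1 opprB exprZn coefB coefZ coefXn.
by rewrite ltn_eqF ?ltnS // mulr0 subr0.
Qed.

(* Main.v *)
(* Encode a partition by its beta numbers p_k = la_k + (l - 1 - k) and let      *)
(* V_k(p) be the column of all S_(p - d)(x_1, ..., x_m, t_1, ..., t_k), with    *)
(* 0 <= d < l; the multi-Schur function is det [V_k(p_k)]. Both sides satisfy   *)
(* the same recursion in the number of x-variables.                             *)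
(* Removing the largest entry from a reverse plane partition leaves a partition *)
(* q inside p, with a weight that is a product over the rows k of               *)
(* f_k(q_k) = \prod_(q_k <= d < p_k) (if d <= p_(k+1) then t_k else x), p_l = -1. *)
(* On the determinant side, adding the variable x turns V_k(p_k) into           *)
(* \sum_q x^(p_k - q) V_k(q); subtracting a multiple of column k + 1 turns this *)
(* into \sum_(q <= p_k) f_k(q) V_k(q), because V_(k+1) arises from V_k in the   *)
(* same way by adding t_k. Expanding the columns gives the recursion, except    *)
(* for terms with q_k <= q_(k+1), which cancel: for b <= p_(k+1) the sum of     *)
(* f_k(q) V_k(q) over q <= b is a multiple of V_(k+1)(b).                       *)
Require Import Defs.
From mathcomp Require Import all_boot all_order all_algebra.
From mathcomp Require Import mpoly.
From mathcomp Require Import perm ring zify.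

Set Implicit Arguments.
Unset Strict Implicit.
Unset Printing Implicit Defensive.

Import Order.TTheory GRing.Theory Num.Theory.
Local Open Scope ring_scope.

(** The recursion described above is [det_geom] for determinants and [rect_groth_branch] for reverse
    plane partitions; [rect_groth_det] matches the two by induction on the number of variables x.
    With no variable x, both sides are 1 for the empty shape and 0 otherwise ([rect_groth0]).

    Equal entries may sit side by side or on top of each other, so the cells holding the largest
    entry can form any skew shape p/q. Such a cell contributes t_k if the cell below it lies in p,
    and x otherwise. To let the shape vary inside one finite type, tableaux are stored as padded
    fillings of a rectangle; [dual_groth_rect] carries the boxwise definition to this model. *)

(** * Complete homogeneous functions and one-letter extensions of the alphabet *)

Section CompleteHomogeneous.
Variable R : comNzRingType.
Implicit Types (a : R) (s : seq R).

Lemma sup_hn0 s : sup_hn s [::] 0 = 1.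
Proof.
rewrite /sup_hn big_nil mul1r; elim: s => [|a s IHs].
  by rewrite big_nil coef1.
by rewrite big_cons coef0M IHs big_ord1 expr0 scale1r coef1 mulr1.
Qed.

Lemma sup_hn_nil m : sup_hn ([::] : seq R) [::] m = (m == 0%N)%:R.
Proof. by rewrite /sup_hn !big_nil mulr1 coef1. Qed.

Lemma sup_hn_perm s1 s2 m :
  perm_eq s1 s2 -> sup_hn s1 [::] m = sup_hn s2 [::] m.
Proof. by move=> eq_s; rewrite /sup_hn (perm_big _ eq_s). Qed.

Lemma sup_hn_consE a s m :
  sup_hn (a :: s) [::] m = \sum_(j < m.+1) a ^+ (m - j) * sup_hn s [::] j.
Proof.
rewrite /sup_hn big_nil mul1r big_cons coefMr; apply: eq_bigr => j _.
rewrite coef_geom ltnS leq_subr mul1r; congr (_ * _).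
apply: (@eq_coef_prod R j) => // b i le_ij.
by rewrite !coef_geom !ltnS le_ij (leq_trans le_ij) // -ltnS.
Qed.

Lemma sup_hn_consS a s m :
  sup_hn (a :: s) [::] m.+1 = sup_hn s [::] m.+1 + a * sup_hn (a :: s) [::] m.
Proof.
rewrite !sup_hn_consE big_ord_recr /= subnn expr0 mul1r addrC; congr (_ + _).
rewrite mulr_sumr; apply: eq_bigr => j _.
by rewrite subSn -1?ltnS // exprS mulrA.
Qed.

Definition hshift s (d p : nat) : R :=
  if (d <= p)%N then sup_hn s [::] (p - d) else 0.

Lemma hshift_perm s1 s2 d p :
  perm_eq s1 s2 -> hshift s1 d p = hshift s2 d p.
Proof. by move=> eq_s; rewrite /hshift (sup_hn_perm _ eq_s). Qed.

(* [V] is the coefficient sequence of [U(v) / (1 - a v)]. *)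
Definition geom a (U V : nat -> R) : Prop :=
  V 0%N = U 0%N /\ forall p, V p.+1 = U p.+1 + a * V p.

(** Adjoining the letter [a] divides the generating function of the S_i by 1 - a v. *)
Lemma hshift_geom a s1 s2 d :
  perm_eq s2 (a :: s1) -> geom a (hshift s1 d) (hshift s2 d).
Proof.
move=> eq_s; split=> [|p]; rewrite !(hshift_perm _ _ eq_s) /hshift.
  by case: d => // ; rewrite !sup_hn0.
case: (ltngtP d p.+1) => [||->].
  by rewrite ltnS => le_dp; rewrite le_dp subSn // sup_hn_consS.
  by rewrite ltnNge => /negbTE lt_pd; rewrite ifF ?mulr0 ?addr0 //; lia.
by rewrite subnn !sup_hn0 ifF ?mulr0 ?addr0 //; lia.
Qed.

(** Partial fractions: x/(1 - x v) - t/(1 - t v) = (x - t)/((1 - x v)(1 - t v)), multiplied by the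
    series of [U]. *)
Lemma geom_exchange x t U U' W W' : geom x U U' -> geom t U W -> geom x W W' ->
  forall p, x * U' p - t * W p = (x - t) * W' p.
Proof.
move=> [U0 US] [W0 WS] [W'0 W'S]; elim=> [|p IHp]; first by rewrite W'0 W0 U0; ring.
rewrite US W'S mulrDr [in RHS]mulrDr [in RHS]mulrCA -IHp WS; ring.
Qed.

Definition wsum (w : nat -> R) (U : nat -> R) (b : nat) : R :=
  \sum_(q < b.+1) (\prod_(q <= d < b) w d) * U q.

Lemma wsum0 w U : wsum w U 0 = U 0%N.
Proof. by rewrite /wsum big_ord1 big_geq // mul1r. Qed.

Lemma wsumS w U b : wsum w U b.+1 = U b.+1 + w b * wsum w U b.
Proof.
rewrite /wsum big_ord_recr /= big_geq // mul1r addrC; congr (_ + _).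
rewrite mulr_sumr; apply: eq_bigr => q _.
by rewrite big_nat_recr -1?ltnS //= mulrAC mulrC mulrA.
Qed.

Lemma wsum_geom a (w : nat -> R) U V b : geom a U V -> (forall d, (d < b)%N -> w d = a) ->
  wsum w U b = V b.
Proof.
move=> [V0 VS]; elim: b => [|b IHb] wE; first by rewrite wsum0 V0.
by rewrite wsumS VS wE // IHb // => d lt_db; apply: wE; apply: ltnW.
Qed.

Lemma wsum_split (w U : nat -> R) b c : (b <= c)%N ->
  \sum_(q < b.+1) (\prod_(q <= d < c) w d) * U q
    = (\prod_(b <= d < c) w d) * wsum w U b.
Proof.
move=> le_bc; rewrite /wsum mulr_sumr; apply: eq_bigr => q _.
have le_qb : (q <= b)%N by rewrite -ltnS.
by rewrite (big_cat_nat le_qb) //= mulrA [in RHS](mulrC (\prod_(b <= d < c) _)).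
Qed.

(** With all weights equal to x the sum would be [U' b]. Using t for the positions up to [a] creates
    the defect (x - t) [W' a] at [a.+1], which each later position multiplies by x. *)
Lemma wsum_exchange x t (U U' W W' : nat -> R) (a b : nat) :
  geom x U U' -> geom t U W -> geom x W W' -> (a < b)%N ->
  wsum (fun d => if (d < a.+1)%N then t else x) U b
    = U' b - x ^+ (b - a.+1) * (x - t) * W' a.
Proof.
move=> gU gW gW'; set w := fun d => _.
elim: b => // b IHb; rewrite ltnS leq_eqVlt => /predU1P[<-|lt_ab].
  rewrite subnn expr0 mul1r -(geom_exchange gU gW gW') wsumS /w ltnSn -/w.
  rewrite (wsum_geom gW) => [|d lt_da]; last by rewrite /w ltnS (ltnW lt_da).
  by case: gU => _ ->; ring.
rewrite wsumS IHb // /w ltnNge lt_ab /= subSS -(subnSK lt_ab) exprS.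
by case: gU => _ ->; ring.
Qed.

End CompleteHomogeneous.

(** * Strictly decreasing sequences of beta numbers *)

Section StrictSequences.
Variables l B : nat.
Implicit Types p q : {ffun 'I_l -> 'I_B}.

(* [ext q k] is [q k + 1], extended by 0 at [k = l] (as if [q l = -1]).        *)
Definition ext q (k : nat) : nat := oapp (fun i : 'I_l => (q i).+1) 0%N (insub k).

Lemma ext_ord q (i : 'I_l) : ext q i = (q i).+1.
Proof. by rewrite /ext valK. Qed.

Lemma ext_out q k : (l <= k)%N -> ext q k = 0%N.
Proof. by move=> le_lk; rewrite /ext insubF // ltnNge le_lk. Qed.

Definition strict q : bool := [forall k : 'I_l, ext q k.+1 <= q k]%N.

Lemma strict_ltn q : strict q -> forall k, (k < l)%N -> (ext q k.+1 < ext q k)%N.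
Proof.
move=> /forallP strict_q k lt_kl.
by rewrite (ext_ord q (Ordinal lt_kl)) ltnS; exact: strict_q (Ordinal lt_kl).
Qed.

Definition update q (j : 'I_l) (v : 'I_B) : {ffun 'I_l -> 'I_B} :=
  [ffun k => if k == j then v else q k].

(** A sum vanishes if it vanishes along every line in direction [j]. Each line is labelled by its
    point whose [j]-th coordinate is an arbitrary fixed [v0]. *)
Lemma sum_update (R : nmodType) (j : 'I_l) (P : pred {ffun 'I_l -> 'I_B}) F :
  (forall q, P q -> \sum_(v | P (update q j v)) F (update q j v) = 0) ->
  \sum_(q | P q) F q = 0 :> R.
Proof.
move=> F0; case: (pickP (fun _ : 'I_B => true)) => [v0 _|B0]; last first.
  by rewrite big1 // => q _; have := B0 (q j).
rewrite (partition_big (fun q => update q j v0) predT) //= big1 // => q0 _.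
have [q0E|q0E] := eqVneq (update q0 j v0) q0; last first.
  rewrite big1 // => q /andP[_ /eqP qE]; case/eqP: q0E; rewrite -qE.
  by apply/ffunP => k; rewrite !ffunE; case: eqP.
rewrite (reindex_onto (update q0 j) (fun q => q j)); last first.
  by move=> q /andP[_ /eqP <-]; apply/ffunP => k; rewrite !ffunE; case: eqP => [->|].
have updK v v' : update (update q0 j v) j v' = update q0 j v'.
  by apply/ffunP => k; rewrite !ffunE; case: eqP.
rewrite (eq_bigl (fun v => P (update q0 j v))); last first.
  by move=> v; rewrite updK q0E !ffunE !eqxx !andbT.
case: (pickP (fun v => P (update q0 j v))) => [v Pv|P0]; last exact: big_pred0.
by rewrite -[RHS](F0 _ Pv); apply: eq_big => [v'|v' _]; rewrite updK.
Qed.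

End StrictSequences.

(** * The recursion for determinants *)

Section DetGeom.
Variables (R : comNzRingType) (l B : nat) (p : {ffun 'I_l -> 'I_B}).
Variables (x : R) (t : nat -> R) (V V' : 'I_l -> nat -> nat -> R).
Hypothesis strict_p : strict p.
Hypothesis V_geom : forall h k, (k.+1 < l)%N -> geom (t k) (V h k) (V h k.+1).
Hypothesis V'_geom : forall h k, geom x (V h k) (V' h k).

Let w (k d : nat) : R := if (d < ext p k.+1)%N then t k else x.

Let detV (q : {ffun 'I_l -> 'I_B}) : R := \det (\matrix_(h < l, k < l) V h k (q k)).

(* Column operations: [wsum_exchange] with [W' = V' h k.+1].                   *)
Lemma det_wsum :
  \det (\matrix_(h < l, k < l) V' h k (p k))
    = \det (\matrix_(h < l, k < l) wsum (w k) (V h k) (p k)).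
Proof.
(* Right multiplication by this unitriangular matrix subtracts from column [k] the multiple of
   column [k.+1] dictated by [wsum_exchange]. The last column stays as it is: there [ext] is 0 and
   every weight is x. *)
pose U := \matrix_(i < l, k < l) (if i == k then 1 else
   if i == k.+1 :> nat then - (x ^+ (p k - (p i).+1) * (x - t k)) else 0) : 'M[R]_l.
have detU : \det U = 1.
  rewrite det_trig; last first.
    apply/is_trig_mxP => i k lt_ik; rewrite mxE.
    by rewrite !ifF //; apply/negbTE; rewrite -?val_eqE /=; lia.
  by rewrite big1 // => i _; rewrite mxE eqxx.
rewrite -[LHS]mulr1 -{1}detU -det_mulmx; congr (\det _).
apply/matrixP => h k; rewrite !mxE (bigD1 k) //= !mxE eqxx mulr1.
have := forallP strict_p k; rewrite /w; case: (ltnP k.+1 l) => [lt_kl|le_lk].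
  rewrite (ext_ord p (Ordinal lt_kl)) => lt_p.
  rewrite (wsum_exchange (V'_geom h k) (V_geom h lt_kl) (V'_geom h k.+1) lt_p).
  rewrite (bigD1 (Ordinal lt_kl)) -?val_eqE /=; last by lia.
  rewrite !mxE -val_eqE /= eqxx gtn_eqF // big1 ?addr0; first by ring.
  move=> i /andP[/negbTE ik /negbTE ik1].
  by rewrite -val_eqE in ik1; rewrite !mxE ik ik1 mulr0.
rewrite ext_out // => _; rewrite big1 ?addr0; last first.
  move=> i /negbTE ik; rewrite !mxE ik ifF ?mulr0 //.
  by apply/negbTE; have := ltn_ord i; lia.
by rewrite (wsum_geom (V'_geom h k)) // => d _; rewrite ltn0.
Qed.

Lemma det_wsum_expand :
  \det (\matrix_(h < l, k < l) wsum (w k) (V h k) (p k))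
    = \sum_(q : {ffun 'I_l -> 'I_B} | [forall k, q k <= p k]%N)
        (\prod_(k < l) \prod_(q k <= d < p k) w k d) * detV q.
Proof.
(* After transposition the Leibniz products run over the columns, so multilinearity is
   distributivity. *)
under [RHS]eq_bigr => q _ do rewrite /detV -det_tr /determinant mulr_sumr.
rewrite exchange_big -det_tr /determinant; apply: eq_bigr => /= s _.
under [RHS]eq_bigr => q _ do rewrite mulrCA -big_split /=.
rewrite -mulr_sumr; congr (_ * _).
pose F (k : 'I_l) (v : nat) := (\prod_(v <= d < p k) w k d) * V ((s : {perm 'I_l}) k) k v.
transitivity (\prod_(k < l) \sum_(v : 'I_B | (v <= p k)%N) F k v).
  apply: eq_bigr => k _; rewrite !mxE /wsum.
  rewrite (big_ord_widen B (F k)) ?ltn_ord ?orbT ?ltn_ord //.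
rewrite bigA_distr_big_dep; apply: eq_big => [q|q _].
  by apply/familyP/forallP.
by apply: eq_bigr => k _; rewrite !mxE.
Qed.


(* The terms with [q j <= q j.+1 = b] cancel once the entries other than [q j] *)
(* are fixed: summing over [q j] turns column [j] into a multiple of           *)
(* [V _ j.+1 b], which is column [j.+1].                                       *)
Lemma sum_violation (j : 'I_l) : (j.+1 < l)%N ->
  \sum_(q : {ffun 'I_l -> 'I_B} |
      [forall k, q k <= p k]%N
        && [forall k : 'I_l, (j < k)%N ==> (ext q k.+1 <= q k)%N]
        && (q j < ext q j.+1)%N)
     (\prod_(k < l) \prod_(q k <= d < p k) w k d) * detV q = 0.
Proof.
move=> lt_jl; pose j1 := Ordinal lt_jl.
have neq_j1 : (j1 == j) = false by rewrite -val_eqE gtn_eqF.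
apply: (sum_update (j := j)) => q /andP[/andP[/forallP le_qp /forallP strict_q]].
have extE v k : (j < k)%N -> ext (update q j v) k = ext q k.
  move=> lt_jk; case: (ltnP k l) => [lt_kl|?]; last by rewrite !ext_out.
  by rewrite !(ext_ord _ (Ordinal lt_kl)) ffunE -val_eqE gtn_eqF.
set b : nat := q j1.
have extj : ext q j.+1 = b.+1 by rewrite (ext_ord q j1).
rewrite extj ltnS => le_qb.
have lt_bp : (b < p j)%N.
  have /forallP/(_ j) := strict_p; rewrite (ext_ord p j1).
  by apply: leq_ltn_trans; exact: le_qp.
pose M (f : 'I_l -> R) := \matrix_(h < l, k < l) (if k == j then f h else V h k (q k)).
pose c := \prod_(k < l | k != j) \prod_(q k <= d < p k) w k d.
(* The cofactors along column [j] do not involve that column, so the determinant is linear in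
   [f]. *)
have detM f : \det (M f) = \sum_h f h * cofactor (M (fun=> 0)) h j.
  rewrite (expand_det_col _ j); apply: eq_bigr => h _; rewrite mxE eqxx.
  congr (_ * (_ * \det _)); apply/matrixP => h' k'; rewrite !mxE.
  by rewrite eq_sym (negbTE (neq_lift _ _)).
transitivity (\sum_(v : 'I_B | (v <= b)%N)
   c * ((\prod_(v <= d < p j) w j d) * \det (M (fun h => V h j v)))).
  (* The conditions at [k > j] do not involve entry [j], and [b < p j]; hence only [v <= b]
     remains. *)
  apply: eq_big => [v|v _].
    rewrite extE // extj !ffunE eqxx ltnS; case: leqP => //= le_vb; rewrite ?andbF //.
    rewrite andbT; apply/andP; split; apply/forallP => k.
      by rewrite ffunE; case: eqP => [->|_]; [exact: leq_trans (ltnW lt_bp) | exact: le_qp].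
    apply/implyP => lt_jk; rewrite (extE v k.+1 (leqW lt_jk)) ffunE -val_eqE gtn_eqF //.
    by apply: (implyP (strict_q k)).
  rewrite (bigD1 j) //= ffunE eqxx -mulrA mulrCA; congr (_ * (_ * _)).
    by apply: eq_bigr => k /negbTE kj; rewrite ffunE kj.
  by congr (\det _); apply/matrixP => h k; rewrite !mxE ffunE; case: eqP => [->|].
have -> : \sum_(v : 'I_B | (v <= b)%N)
      c * ((\prod_(v <= d < p j) w j d) * \det (M (fun h => V h j v)))
    = c * ((\prod_(b <= d < p j) w j d) * \det (M (fun h => V h j.+1 b))).
  rewrite -mulr_sumr; congr (_ * _).
  under [LHS]eq_bigr => v _ do rewrite detM mulr_sumr.
  rewrite exchange_big detM mulr_sumr; apply: eq_bigr => h _ /=.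
  under eq_bigr => v _ do rewrite mulrA.
  rewrite -mulr_suml mulrA; congr (_ * _).
  (* All [d < b] lie below p_(j+1), so they carry the constant weight t_j. *)
  rewrite -(wsum_geom (w := w j) (V_geom h lt_jl)); last first.
    by move=> d lt_db; rewrite /w ifT // (ext_ord p j1) ltnS (leq_trans (ltnW lt_db)) // le_qp.
  rewrite -wsum_split ?(ltnW lt_bp) //.
  by rewrite (big_ord_widen B (fun v => (\prod_(v <= d < p j) w j d) * V h j v)) ?ltn_ord.
rewrite -det_tr (determinant_alternate (i1 := j) (i2 := j1)) ?mulr0 //.
  by rewrite eq_sym neq_j1.
by move=> h; rewrite !mxE eqxx neq_j1.
Qed.

(** Strictness is imposed one index at a time, from the last one downwards. The terms discarded at
    [j] are then strict beyond [j], as [sum_violation] requires; at the last index nothing is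
    discarded. *)
Lemma det_geom :
  \det (\matrix_(h < l, k < l) V' h k (p k))
    = \sum_(q : {ffun 'I_l -> 'I_B} | strict q && [forall k, q k <= p k]%N)
        (\prod_(k < l) \prod_(q k <= d < p k) w k d) * detV q.
Proof.
rewrite det_wsum det_wsum_expand.
pose C (j : nat) (q : {ffun 'I_l -> 'I_B}) :=
  [forall k : 'I_l, (j <= k)%N ==> (ext q k.+1 <= q k)%N].
pose le_p (q : {ffun 'I_l -> 'I_B}) := [forall k : 'I_l, q k <= p k]%N.
pose F (q : {ffun 'I_l -> 'I_B}) :=
  (\prod_(k < l) \prod_(q k <= d < p k) w k d) * detV q.
suffices sumC i : (i <= l)%N ->
    \sum_(q | le_p q) F q = \sum_(q | le_p q && C (l - i)%N q) F q.
  rewrite (sumC l) // subnn; apply: eq_bigl => q; rewrite andbC; congr (_ && _).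
elim: i => [_|i IHi lt_il].
  apply: eq_bigl => q; rewrite [C _ _](_ : _ = true) ?andbT //.
  by apply/forallP => k; rewrite subn0 leqNgt ltn_ord.
have lt_jl : (l - i.+1 < l)%N by lia.
pose j := Ordinal lt_jl; have jE : (l - i = j.+1)%N by rewrite /=; lia.
rewrite (IHi (ltnW lt_il)) // (bigID (fun q : {ffun 'I_l -> 'I_B} => q j < ext q j.+1)%N) /=.
rewrite [X in X + _](_ : _ = 0) ?add0r; last first.
  case: (ltnP j.+1 l) => [lt_j1l|le_lj].
    by rewrite -[RHS](sum_violation lt_j1l) jE.
  by rewrite big_pred0 // => q; rewrite ext_out // ltn0 andbF.
apply: eq_bigl => q; rewrite -andbA -leqNgt jE; congr (_ && _).
apply/andP/forallP => [[/forallP Cq le_j] k|Cq].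
  rewrite leq_eqVlt; case: eqP => [jk|_] /=; last exact: Cq.
  by rewrite (_ : k = j) //; apply: val_inj.
split; last by have /implyP := Cq j; apply.
by apply/forallP => k; apply/implyP => /ltnW; apply/implyP/Cq.
Qed.

End DetGeom.

Lemma sum_ltn_ord (M m : nat) : (m <= M)%N -> (\sum_(j < M) (j < m) = m)%N.
Proof.
move=> le_mM; rewrite -big_mkcond /= -(big_ord_widen M (fun=> 1%N)) //.
by rewrite sum1_card card_ord.
Qed.

(** Such a [b] is the indicator of an initial segment, whose length is the sum. *)
Lemma antitone_count (M : nat) (b : nat -> bool) :
  (forall c, b c.+1 -> b c) ->
  forall c, (c < M)%N -> (c < \sum_(j < M) b j)%N = b c.
Proof.
move=> b_anti c lt_cM.
have b_le i j : (i <= j)%N -> b j -> b i.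
  by move=> /subnK <-; elim: (j - i)%N => //= k IHk; rewrite addSn => /b_anti.
have [bc|nbc] := boolP (b c).
  rewrite -[X in (X <= _)%N](sum_ltn_ord lt_cM); apply: leq_sum => j _.
  by case: ltnP => // le_jc; rewrite (b_le j c).
apply/negbTE; rewrite -leqNgt -[X in (_ <= X)%N](sum_ltn_ord (ltnW lt_cM)).
apply: leq_sum => j _; case: ltnP => [_|le_cj]; first exact: leq_b1.
by case bj: (b j) => //; rewrite (b_le c j) in nbc.
Qed.

(** * Reverse plane partitions as padded fillings of a rectangle *)

Section RectangularFillings.
Variables l M N : nat.
Implicit Types (T : {ffun 'I_l * 'I_M -> 'I_N.+1}).
Implicit Types (p q : {ffun 'I_l -> 'I_(M + l)}).

(* Outside the rectangle the value is the largest entry [N]. *)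
Definition ev T (r c : nat) : nat :=
  if insub r is Some i then if insub c is Some j then T (i, j) : nat else N else N.

Lemma ev_ord T (i : 'I_l) (j : 'I_M) : ev T i j = T (i, j).
Proof. by rewrite /ev !valK. Qed.

Lemma ev_out T r c : ~~ ((r < l) && (c < M))%N -> ev T r c = N.
Proof.
rewrite /ev negb_and -!leqNgt; case: insubP => [i lt_rl _|//].
by rewrite leqNgt lt_rl; case: insubP => [j lt_cM _|//]; rewrite leqNgt lt_cM.
Qed.

Lemma ev_leq T r c : (ev T r c <= N)%N.
Proof. by rewrite /ev; case: insubP => // i _ _; case: insubP => // j _ _; rewrite -ltnS. Qed.

Lemma ev_inj T T' : (forall r c, ev T r c = ev T' r c) -> T = T'.
Proof. by move=> eqT; apply/ffunP => -[i j]; apply: val_inj; rewrite /= -!ev_ord. Qed.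

Definition rect (g : nat -> nat -> nat) : {ffun 'I_l * 'I_M -> 'I_N.+1} :=
  [ffun ij : 'I_l * 'I_M => inord (g ij.1 ij.2)].

Lemma ev_rect g r c : (g r c <= N)%N ->
  (~~ ((r < l) && (c < M))%N -> g r c = N) -> ev (rect g) r c = g r c.
Proof.
have [/andP[lt_rl lt_cM] le_g _|out _ ->//] := boolP ((r < l) && (c < M))%N; last exact: ev_out.
by rewrite (ev_ord _ (Ordinal lt_rl) (Ordinal lt_cM)) ffunE inordK.
Qed.

(* [p] encodes the shape with row lengths [p r - (l - 1 - r)]. *)
Definition inshape p (r c : nat) : bool := (c + (l - r) < ext p r)%N.

(** With [strict_geq], this bounds each row length [ext p r - (l - r)] by 0 and [M]: the shape fits
    in the rectangle. *)
Lemma strict_leq p r : strict p -> (r <= l)%N -> (ext p r <= M + (l - r))%N.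
Proof.
move=> strict_p; elim: r => [|r IHr] lt_rl.
  case: (posnP l) => [l0|l_gt0]; first by rewrite ext_out ?l0.
  by rewrite (ext_ord p (Ordinal l_gt0)) subn0 ltn_ord.
by have := strict_ltn strict_p lt_rl; have := IHr (ltnW lt_rl); lia.
Qed.

Lemma strict_geq p r : strict p -> (l - r <= ext p r)%N.
Proof.
move=> strict_p; move: {2}(l - r)%N (erefl (l - r)%N) => m; elim: m r => [r -> //|m IHm r lmr].
by have := @strict_ltn _ _ p strict_p r; have := IHm r.+1; lia.
Qed.

Lemma inshape_ord p (i : 'I_l) c : inshape p i c = (c + (l.-1 - i) < p i)%N.
Proof. by rewrite /inshape ext_ord; have := ltn_ord i; lia. Qed.

Lemma inshape_in p r c : strict p -> inshape p r c -> ((r < l) && (c < M))%N.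
Proof.
rewrite /inshape => strict_p; case: (ltnP r l) => [lt_rl|le_lr]; last by rewrite ext_out.
by have := strict_leq strict_p (ltnW lt_rl); lia.
Qed.

Lemma inshape_up p r c : strict p -> inshape p r.+1 c -> inshape p r c.
Proof.
move=> strict_p in_p; have /andP[lt_rl _] := inshape_in strict_p in_p.
by move: in_p; rewrite /inshape; have := strict_ltn strict_p (ltnW lt_rl); lia.
Qed.

Lemma inshape_left p r c : inshape p r c.+1 -> inshape p r c.
Proof. by rewrite /inshape; lia. Qed.

Lemma inshape_leq p q r c : (forall k, q k <= p k)%N -> inshape q r c -> inshape p r c.
Proof.
move=> le_qp; case: (ltnP r l) => [lt_rl|le_lr]; last by rewrite /inshape ext_out.
by rewrite !(inshape_ord _ (Ordinal lt_rl)) => /leq_trans; apply.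
Qed.

(** The boxes of the shape are the cells with entry below [n]; all other cells hold the padding [N].
    As [N] is maximal, monotonicity across the border of the shape is automatic. *)
Definition rect_rpp n p T : bool :=
  [forall i : 'I_l, forall j : 'I_M,
    [&& (ev T i j <= ev T i.+1 j)%N, (ev T i j <= ev T i j.+1)%N,
        (ev T i j < n)%N == inshape p i j & (n <= ev T i j)%N ==> (ev T i j == N)]].

Lemma rect_rppP n p T : (n <= N)%N -> strict p ->
  reflect [/\ forall r c, (ev T r c <= ev T r.+1 c)%N,
              forall r c, (ev T r c <= ev T r c.+1)%N,
              forall r c, (ev T r c < n)%N = inshape p r c
            & forall r c, (n <= ev T r c)%N -> ev T r c = N]
          (rect_rpp n p T).
Proof.
move=> le_nN strict_p; apply: (iffP idP) => [/forallP Trpp|[Tcol Trow Tin Tout]]; last first.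
  apply/forallP => i; apply/forallP => j; rewrite Tcol Trow Tin eqxx /=.
  by apply/implyP => /Tout ->.
have inP r c : (r < l)%N -> (c < M)%N ->
    [/\ (ev T r c <= ev T r.+1 c)%N, (ev T r c <= ev T r c.+1)%N,
        (ev T r c < n)%N = inshape p r c & (n <= ev T r c)%N -> ev T r c = N].
  move=> lt_rl lt_cM; have /forallP/(_ (Ordinal lt_cM)) := Trpp (Ordinal lt_rl).
  by case/and4P => ? ? /eqP ? /implyP ?; split=> // ?; apply/eqP; auto.
split=> r c; have [/andP[/inP lt_rl /lt_rl[]]|out] // := boolP ((r < l) && (c < M))%N.
- rewrite [ev T r.+1 c]ev_out ?ev_leq //; move: out; lia.
- rewrite [ev T r c.+1]ev_out ?ev_leq //; move: out; lia.
- rewrite ev_out // ltnNge le_nN; apply/esym/negbTE; apply: contra out; exact: inshape_in.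
- by rewrite ev_out.
Qed.

(** Erases the entry [n]; [fill] puts it back into the vacant cells of the larger shape. *)
Definition cap n T := rect (fun r c => if (ev T r c < n)%N then ev T r c else N).

Lemma ev_cap n T r c : ev (cap n T) r c = if (ev T r c < n)%N then ev T r c else N.
Proof.
rewrite ev_rect //; first by case: ifP => _ //; exact: ev_leq.
by move=> out; rewrite ev_out // if_same.
Qed.

Definition fill n p T := rect (fun r c => if (ev T r c < n)%N then ev T r c
  else if inshape p r c then n else N).

Lemma ev_fill n p T r c : (n <= N)%N -> strict p ->
  ev (fill n p T) r c
    = if (ev T r c < n)%N then ev T r c else if inshape p r c then n else N.
Proof.
move=> le_nN strict_p; rewrite ev_rect //.
  by case: ifP => _; [exact: ev_leq | case: ifP].
move=> out; rewrite ev_out // ifF; last by rewrite ltnNge le_nN.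
rewrite ifF //; apply/negbTE; apply: contra out; exact: inshape_in.
Qed.

Lemma lt_shape_subproof n T (i : 'I_l) :
  (\sum_(j < M) (ev T i j < n) + (l.-1 - i) < M + l)%N.
Proof.
have : (\sum_(j < M) (ev T i j < n) <= M)%N.
  rewrite -[X in (_ <= X)%N]card_ord -sum1_card; apply: leq_sum => j _; exact: leq_b1.
by have := ltn_ord i; lia.
Qed.

Definition lt_shape n T : {ffun 'I_l -> 'I_(M + l)} :=
  [ffun i => Ordinal (lt_shape_subproof n T i)].

Lemma inshape_lt_shape n T r c : (n <= N)%N ->
  (forall r c, ev T r c <= ev T r c.+1)%N ->
  inshape (lt_shape n T) r c = (ev T r c < n)%N.
Proof.
move=> le_nN Trow; have [/andP[lt_rl lt_cM]|out] := boolP ((r < l) && (c < M))%N.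
  rewrite (inshape_ord _ (Ordinal lt_rl)) ffunE /= ltn_add2r.
  rewrite (antitone_count (M := M) (b := fun j => ev T r j < n)%N) // => j.
  exact: leq_ltn_trans.
rewrite ev_out // [RHS]ltnNge le_nN; apply/negbTE; move: out.
case: (ltnP r l) => [lt_rl|le_lr _]; last by rewrite /inshape ext_out.
rewrite -leqNgt (inshape_ord _ (Ordinal lt_rl)) ffunE /= ltn_add2r -leqNgt; apply: leq_trans.
rewrite -[X in (_ <= X)%N]card_ord -sum1_card; apply: leq_sum => j _; exact: leq_b1.
Qed.

Lemma strict_lt_shape n T : (forall r c, ev T r c <= ev T r.+1 c)%N -> strict (lt_shape n T).
Proof.
move=> Tcol; apply/forallP => i; case: (ltnP i.+1 l) => [lt_il|le_li]; last by rewrite ext_out.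
rewrite (ext_ord _ (Ordinal lt_il)) !ffunE /=.
rewrite -addnS leq_add //; last by lia.
apply: leq_sum => j _; case: ltnP => // lt_T.
by rewrite (leq_ltn_trans (Tcol _ _) lt_T).
Qed.

Lemma lt_shape_uniq n q T : strict q -> (forall r c, (ev T r c < n)%N = inshape q r c) ->
  lt_shape n T = q.
Proof.
move=> strict_q Tin; apply/ffunP => i; apply: val_inj; rewrite ffunE /=.
transitivity (\sum_(j < M) (j < ext q i - (l - i)) + (l.-1 - i))%N.
  congr (_ + _)%N; apply: eq_bigr => j _; congr nat_of_bool.
  by rewrite Tin /inshape; lia.
have := strict_geq i strict_q; have := strict_leq strict_q (ltnW (ltn_ord i)).
by rewrite ext_ord => le_q ge_q; rewrite sum_ltn_ord; have := ltn_ord i; lia.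
Qed.

(** Half of the bijection behind the branching rule; [rect_rpp_fill] is the converse. Monotonicity
    makes the cells with entry below [n] a shape, and [n < N] separates the entry [n] from the
    padding. *)
Lemma rect_rpp_cap n p T : (n < N)%N -> strict p -> rect_rpp n.+1 p T ->
  [/\ strict (lt_shape n T), forall k, (lt_shape n T k <= p k)%N,
      rect_rpp n (lt_shape n T) (cap n T) & fill n p (cap n T) = T].
Proof.
move=> lt_nN strict_p /rect_rppP[] // Tcol Trow Tin Tout.
have strict_s := strict_lt_shape n Tcol.
have s_in r c := inshape_lt_shape r c (ltnW lt_nN) Trow.
split=> // [k||].
- have : (\sum_(j < M) (ev T k j < n) <= \sum_(j < M) (j < ext p k - (l - k)))%N.
    apply: leq_sum => j _; case: (ltnP (ev T k j) n) => // /leqW.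
    by rewrite Tin /inshape; case: leqP => //; lia.
  have := strict_geq k strict_p; have := strict_leq strict_p (ltnW (ltn_ord k)).
  rewrite ffunE ext_ord => le_p ge_p /=; rewrite sum_ltn_ord; last by lia.
  by have := ltn_ord k; lia.
- apply/rect_rppP; [exact: ltnW | by [] | split=> r c; rewrite !ev_cap].
  + by have := Tcol r c; have := ev_leq T r c; case: ifP; case: ifP; lia.
  + by have := Trow r c; have := ev_leq T r c; case: ifP; case: ifP; lia.
  + by rewrite s_in; case: ifP => //; lia.
  + by case: ifP => //; lia.
apply: ev_inj => r c; rewrite (ev_fill _ _ _ (ltnW lt_nN) strict_p) ev_cap.
case lt_T: (ev T r c < n)%N => /=; first by rewrite lt_T.
rewrite ltnNge (ltnW lt_nN) /= -Tin.
by case: ltnP => [|/Tout ->] //; lia.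
Qed.

Lemma rect_rpp_fill n p q T : (n < N)%N -> strict p -> strict q ->
  (forall k, q k <= p k)%N -> rect_rpp n q T ->
  [/\ rect_rpp n.+1 p (fill n p T), lt_shape n (fill n p T) = q & cap n (fill n p T) = T].
Proof.
move=> lt_nN strict_p strict_q le_qp /(rect_rppP _ (ltnW lt_nN) strict_q)[Tcol Trow Tin Tout].
have evE r c := ev_fill T r c (ltnW lt_nN) strict_p.
have in_qp r c := @inshape_leq p q r c le_qp.
split.
- apply/rect_rppP => //; split=> r c; rewrite !evE.
  + have := Tcol r c; have := Tin r c; have := Tin r.+1 c.
    have := @inshape_up p r c strict_p; have := in_qp r c.
    have := ev_leq T r.+1 c.
    by do ! (case: ifP => /=); lia.
  + have := Trow r c; have := Tin r c; have := Tin r c.+1.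
    have := @inshape_left p r c; have := in_qp r c.
    have := ev_leq T r c.+1.
    by do ! (case: ifP => /=); lia.
  + by have := Tin r c; have := in_qp r c; do ! (case: ifP => /=); lia.
  + by do ! (case: ifP => /=); lia.
- apply: lt_shape_uniq => // r c; rewrite evE -Tin.
  by do ! (case: ifP => /=); lia.
apply: ev_inj => r c; rewrite ev_cap !evE.
by have := Tout r c; do ! (case: ifP => /=); lia.
Qed.

End RectangularFillings.

(** Passes from the columns [j] of row [i] to the beta positions [j + (l.-1 - i)] used in
    [branch_weight]. *)
Lemma big_ord_nat_shift (R : Type) (idx : R) (op : Monoid.com_law idx)
    (M m n a : nat) (F : nat -> R) : (a <= m)%N -> (n <= M + a)%N ->
  \big[op/idx]_(j < M | (m <= j + a < n)%N) F (j + a)%N = \big[op/idx]_(m <= d < n) F d.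
Proof.
move=> le_am le_nM; rewrite -{2}(subnK le_am) big_addn.
have le_n : (n - a <= M)%N by lia.
rewrite (big_nat_widen _ _ _ _ _ le_n) (big_nat_widenl _ 0) // big_mkord.
by apply: eq_bigl => j; rewrite /=; lia.
Qed.

(** * The branching rule and the determinant formula for rectangular fillings *)

Section Branching.
Variables (R : comNzRingType) (l M N : nat) (x t : nat -> R).
Implicit Types (T : {ffun 'I_l * 'I_M -> 'I_N.+1}).
Implicit Types (p q : {ffun 'I_l -> 'I_(M + l)}).

(* A vertical run of equal entries [k] in rows [i], ..., [i'] of a column      *)
(* contributes [t_i ... t_(i' - 1) x_k], with [x_k] carried by its lowest box. *)
Definition weight n T : R :=
  \prod_(i < l) \prod_(j < M | (ev T i j < n)%N)
     (if ev T i.+1 j == ev T i j then t i else x (ev T i j)).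

(** Position [d] in row [k] stands for the cell in column [d - (l.-1 - k)]; the test on [d] says
    that the cell below it also lies in the shape of [p]. *)
Definition branch_weight n p q : R :=
  \prod_(k < l) \prod_(q k <= d < p k) (if (d < ext p k.+1)%N then t k else x n).

Definition rect_groth n p : R :=
  \sum_(T : {ffun 'I_l * 'I_M -> 'I_N.+1} | rect_rpp n p T) weight n T.

(** Below a new [n] inside the shape there is again an [n], giving t_i; outside it there is [N],
    giving x_n. Old cells keep their factor: a padding cell below one of them becomes [n] or stays
    [N], and both exceed the old entry. *)
Lemma weight_fill n p q T : (n < N)%N -> strict p -> strict q ->
  (forall k, q k <= p k)%N -> rect_rpp n q T ->
  weight n.+1 (fill n p T) = branch_weight n p q * weight n T.
Proof.
move=> lt_nN strict_p strict_q le_qp /(rect_rppP _ (ltnW lt_nN) strict_q)[Tcol _ Tin Tout].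
have evE r c := ev_fill T r c (ltnW lt_nN) strict_p.
have in_qp r c := @inshape_leq _ _ p q r c le_qp.
rewrite /weight /branch_weight -big_split; apply: eq_bigr => i _ /=.
have lt_il := ltn_ord i.
have ge_q : (l.-1 - i <= q i)%N.
  by have := strict_geq i strict_q; rewrite ext_ord; lia.
have le_p : (p i <= M + (l.-1 - i))%N.
  by have := strict_leq strict_p (ltnW lt_il); rewrite ext_ord; lia.
rewrite (bigID (fun j : 'I_M => (ev T i j < n)%N)) [LHS]mulrC /=; congr (_ * _).
  rewrite -(big_ord_nat_shift _ _ ge_q le_p); apply: eq_big => [j|j].
    rewrite evE Tin [in RHS]leqNgt -!inshape_ord andbC.
    by case: (inshape q i j) => //; case: (inshape p i j) => /=; lia.
  rewrite !evE => /andP[]; case lt_T: (ev T i j < n)%N => //= + _.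
  case in_p: (inshape p i j); last by lia.
  move=> _; have -> : (ev T i.+1 j < n)%N = false.
    by apply/negbTE; move: (Tcol i j) lt_T; lia.
  rewrite (_ : (j + _ < _)%N = inshape p i.+1 j); last by rewrite /inshape; lia.
  by case: (inshape p i.+1 j); rewrite ?eqxx ?gtn_eqF.
apply: eq_big => [j|j].
  by rewrite evE; case lt_T: (ev T i j < n)%N => /=; rewrite ?andbF //; lia.
rewrite !evE => /andP[_ lt_T]; rewrite lt_T.
case: (ltnP (ev T i.+1 j) n) => // le_nT.
congr (if _ then _ else _); rewrite [RHS]gtn_eqF ?(leq_trans lt_T) //.
by rewrite gtn_eqF //; case: ifP; lia.
Qed.

Lemma rect_groth_branch n p : (n < N)%N -> strict p ->
  rect_groth n.+1 p =
    \sum_(q : {ffun 'I_l -> 'I_(M + l)} | strict q && [forall k, q k <= p k]%N)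
       branch_weight n p q * rect_groth n q.
Proof.
move=> lt_nN strict_p; rewrite /rect_groth.
rewrite (partition_big (lt_shape n)
    (fun q => strict q && [forall k, q k <= p k]%N)) /=; last first.
  move=> T /(rect_rpp_cap lt_nN strict_p)[-> le_s _ _].
  by apply/forallP.
apply: eq_bigr => q /andP[strict_q /forallP le_qp]; rewrite mulr_sumr.
rewrite (reindex_onto (fill n p) (cap n)) /=; last first.
  by move=> T /andP[/(rect_rpp_cap lt_nN strict_p)[]].
apply: eq_big => [T|T /andP[/andP[Trpp /eqP Ts] /eqP TK]]; last first.
  apply: weight_fill => //.
  by have [_ _] := rect_rpp_cap lt_nN strict_p Trpp; rewrite Ts TK.
apply/andP/idP => [[/andP[Trpp /eqP Ts] /eqP TK]|Trpp].
  by have [_ _] := rect_rpp_cap lt_nN strict_p Trpp; rewrite Ts TK.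
by have [-> -> ->] := rect_rpp_fill lt_nN strict_p strict_q le_qp Trpp; rewrite !eqxx.
Qed.

(** Only the constant filling [N] can occur, and only for the empty shape, where the matrix is
    unitriangular. For a nonempty shape p_0 >= l, and column 0, whose alphabet is empty,
    vanishes. *)
Lemma rect_groth0 p : strict p ->
  rect_groth 0 p = \det (\matrix_(h < l, k < l) hshift (mkseq t k) (l.-1 - h) (p k)).
Proof.
move=> strict_p; case: (ltnP l (ext p 0)) => [lt_lp|le_pl].
  have in00 : inshape p 0 0 by rewrite /inshape subn0.
  have /andP[l_gt0 _] := inshape_in strict_p in00.
  pose i0 := Ordinal l_gt0.
  rewrite /rect_groth big_pred0 => [|T]; last first.
    by apply/negbTE/negP => /(rect_rppP _ (leq0n N) strict_p)[_ _ /(_ 0%N 0%N)]; rewrite in00.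
  rewrite (expand_det_col _ i0) big1 // => h _; rewrite mxE /hshift /= sup_hn_nil.
  rewrite (ext_ord p i0) in lt_lp.
  by rewrite (_ : (p i0 - _ == 0)%N = false) ?if_same ?mul0r //; have := ltn_ord h; lia.
have pE (k : 'I_l) : p k = (l.-1 - k)%N :> nat.
  have ext_le r : (r <= l)%N -> (ext p r <= l - r)%N.
    elim: r => [|r IHr] lt_rl; first by rewrite subn0.
    by have := strict_ltn strict_p lt_rl; have := IHr (ltnW lt_rl); lia.
  have := ext_le _ (ltnW (ltn_ord k)); have := strict_geq k strict_p.
  by rewrite ext_ord; have := ltn_ord k; lia.
have inF r c : inshape p r c = false.
  case: (ltnP r l) => [lt_rl|le_lr]; last by rewrite /inshape ext_out.
  by rewrite (inshape_ord _ (Ordinal lt_rl)) pE /=; lia.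
pose T0 : {ffun 'I_l * 'I_M -> 'I_N.+1} := [ffun => ord_max].
have evN r c : ev T0 r c = N.
  have [/andP[lt_rl lt_cM]|] := boolP ((r < l) && (c < M))%N; last exact: ev_out.
  by rewrite (ev_ord _ (Ordinal lt_rl) (Ordinal lt_cM)) ffunE.
rewrite /rect_groth (big_pred1 T0) => [|T]; last first.
  apply/(rect_rppP _ (leq0n N) strict_p)/eqP => [[_ _ _ Tout]|->].
    by apply: ev_inj => r c; rewrite evN Tout.
  by split=> r c; rewrite ?evN ?inF.
rewrite det_trig; last first.
  apply/is_trig_mxP => h k lt_hk; rewrite mxE /hshift pE ifF //.
  by have := ltn_ord k; lia.
rewrite [RHS]big1 => [|k _]; last by rewrite mxE /hshift pE leqnn subnn sup_hn0.
by rewrite /weight big1 // => i _; rewrite big_pred0.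
Qed.

Lemma rect_groth_det n p : (n <= N)%N -> strict p ->
  rect_groth n p = \det (\matrix_(h < l, k < l)
     hshift (mkseq x n ++ mkseq t k) (l.-1 - h) (p k)).
Proof.
elim: n p => [|n IHn] p lt_nN strict_p.
  exact: rect_groth0.
rewrite rect_groth_branch //
  (det_geom (x := x n) (t := t)
    (V := fun h k => hshift (mkseq x n ++ mkseq t k) (l.-1 - h))
    (V' := fun h k => hshift (mkseq x n.+1 ++ mkseq t k) (l.-1 - h))) //.
- by apply: eq_bigr => q /andP[strict_q _]; rewrite (IHn q (ltnW lt_nN)).
- move=> h k _; apply: hshift_geom.
  rewrite /mkseq -addn1 iotaD map_cat /= catA.
  by rewrite perm_catC.
move=> h k; apply: hshift_geom.
rewrite /mkseq -(addn1 n) iotaD map_cat /= -catA.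
by rewrite perm_sym -cat1s perm_catCA.
Qed.

End Branching.

(** * From fillings of boxes to padded rectangular fillings *)

Section BoxFillings.
Variables (n : nat) (la : seq nat).
Hypothesis la_sorted : sorted geq la.

Local Notation l := (size la).
Local Notation M := (head 0%N la).

Lemma part_antitone r : (nth 0%N la r.+1 <= nth 0%N la r)%N.
Proof.
case: (ltnP r.+1 l) => [|le_lr]; last by rewrite nth_default.
by have /(sortedP 0%N)/(_ r) := la_sorted; apply.
Qed.

Lemma part_leq r s : (r <= s)%N -> (nth 0%N la s <= nth 0%N la r)%N.
Proof.
move=> /subnKC <-; elim: (s - r)%N => [|m IHm]; first by rewrite addn0.
by rewrite addnS; apply: leq_trans (part_antitone _) IHm.
Qed.

Lemma part_le_head r : (nth 0%N la r <= M)%N.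
Proof. by rewrite -nth0; apply: part_leq. Qed.

Lemma box_ex r c : (c < nth 0%N la r)%N -> exists2 b : box la, brow b = r & bcol b = c.
Proof.
case: (ltnP r l) => [lt_rl lt_c|le_lr]; last by rewrite nth_default.
by exists (Tagged (fun r : 'I_l => 'I_(nth 0%N la r))
  (Ordinal (lt_c : (c < nth 0%N la (Ordinal lt_rl))%N))).
Qed.

Lemma bcol_lt (b : box la) : (bcol b < nth 0%N la (brow b))%N.
Proof. exact: ltn_ord. Qed.

Lemma bcol_lt_head (b : box la) : (bcol b < M)%N.
Proof. exact: leq_trans (bcol_lt b) (part_le_head _). Qed.

Lemma brow_lt (b : box la) : (brow b < l)%N.
Proof. exact: ltn_ord. Qed.

Lemma box_inj (b c : box la) : brow b = brow c -> bcol b = bcol c -> b = c.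
Proof.
case: b c => [r j] [r' j']; rewrite /brow /bcol /= => /val_inj Er; case: r' / Er j' => j'.
by move=> /val_inj ->.
Qed.

Lemma beta_subproof (k : 'I_l) : (nth 0%N la k + (l.-1 - k) < M + l)%N.
Proof. by have := part_le_head k; have := ltn_ord k; lia. Qed.

Definition beta : {ffun 'I_l -> 'I_(M + l)} := [ffun k => Ordinal (beta_subproof k)].

Lemma inshape_beta r c : inshape beta r c = (c < nth 0%N la r)%N.
Proof.
case: (ltnP r l) => [lt_rl|le_lr]; last by rewrite /inshape ext_out // nth_default.
by rewrite (inshape_ord _ (Ordinal lt_rl)) ffunE /= ltn_add2r.
Qed.

Lemma strict_beta : strict beta.
Proof.
apply/forallP => k; case: (ltnP k.+1 l) => [lt_kl|le_lk]; last by rewrite ext_out.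
rewrite (ext_ord _ (Ordinal lt_kl)) !ffunE /=.
by have := part_antitone k; lia.
Qed.

(** Here [N = n]: the entries are below [n], so the value [n] is free to serve as padding. *)
Definition to_rect (T : filling n la) : {ffun 'I_l * 'I_M -> 'I_n.+1} :=
  [ffun ij : 'I_l * 'I_M =>
     oapp (fun b => widen_ord (leqnSn n) (T b)) ord_max
          [pick b : box la | (brow b == ij.1) && (bcol b == ij.2)]].

Lemma ev_to_rect T b : ev (to_rect T) (brow b) (bcol b) = T b.
Proof.
rewrite (ev_ord _ (Ordinal (brow_lt b)) (Ordinal (bcol_lt_head b))) ffunE /=.
case: pickP => [c /andP[/eqP Er /eqP Ec]|/(_ b)]; last by rewrite !eqxx.
by rewrite (box_inj Er Ec).
Qed.

Lemma ev_to_rect_out T r c : (nth 0%N la r <= c)%N -> ev (to_rect T) r c = n.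
Proof.
move=> le_c; have [/andP[lt_rl lt_cM]|] := boolP ((r < l) && (c < M))%N; last exact: ev_out.
rewrite (ev_ord _ (Ordinal lt_rl) (Ordinal lt_cM)) ffunE /=.
case: pickP => //= b /andP[/eqP Er /eqP Ec].
by have := bcol_lt b; rewrite Er Ec; lia.
Qed.

Lemma ev_to_rect_lt T r c : (ev (to_rect T) r c < n)%N = (c < nth 0%N la r)%N.
Proof.
case: (ltnP c) => [/box_ex[b <- <-]|le_c]; first by rewrite ev_to_rect ltn_ord.
by rewrite ev_to_rect_out // ltnn.
Qed.

(** [is_rpp] compares any two boxes of a row or column, [rect_rpp] only neighbouring cells;
    transitivity bridges the two. *)
Lemma rect_rpp_to_rect T : rect_rpp n beta (to_rect T) = is_rpp T.
Proof.
apply/(rect_rppP _ (leqnn n) strict_beta)/andP.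
  move=> [Tcol Trow _ _].
  split; apply/forallP => b; apply/forallP => c; apply/implyP => /andP[/eqP E le_bc].
    rewrite -!ev_to_rect E.
    exact: (homo_leq (f := ev (to_rect T) (brow c)) leqnn (@leq_trans) (Trow _)).
  rewrite -!ev_to_rect E.
  exact: (homo_leq (f := fun r => ev (to_rect T) r (bcol c)) leqnn (@leq_trans) (Tcol^~ _)).
case=> /forallP Trow /forallP Tcol; split=> r c.
- case: (ltnP c (nth 0%N la r.+1)) => [lt_c|/ev_to_rect_out ->]; last exact: ev_leq.
  have [b Er Ec] := box_ex lt_c; have [b' Er' Ec'] := box_ex (leq_trans lt_c (part_antitone r)).
  rewrite -Er -{1}Er' -{1}Ec' -Ec !ev_to_rect.
  by have /forallP/(_ b)/implyP := Tcol b'; apply; rewrite Ec Ec' Er Er' eqxx leqnSn.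
- case: (ltnP c.+1 (nth 0%N la r)) => [lt_c|/ev_to_rect_out ->]; last exact: ev_leq.
  have [b Er Ec] := box_ex lt_c; have [b' Er' Ec'] := box_ex (ltnW lt_c).
  rewrite -Ec -{1}Er' -{1}Ec' -Er !ev_to_rect.
  by have /forallP/(_ b)/implyP := Trow b'; apply; rewrite Ec Ec' Er Er' eqxx leqnSn.
- by rewrite ev_to_rect_lt inshape_beta.
by rewrite leqNgt ev_to_rect_lt -leqNgt => /ev_to_rect_out ->.
Qed.

Lemma to_rect_inj : injective to_rect.
Proof.
move=> T T' E; apply/ffunP => b; apply: val_inj => /=.
by rewrite -!ev_to_rect E.
Qed.

Lemma to_rect_onto T' : rect_rpp n beta T' -> exists T, to_rect T = T'.
Proof.
move=> /(rect_rppP _ (leqnn n) strict_beta)[_ _ Tin Tout].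
have lt_T' (b : box la) : (ev T' (brow b) (bcol b) < n)%N.
  by rewrite Tin inshape_beta bcol_lt.
exists [ffun b => Ordinal (lt_T' b)]; apply: ev_inj => r c.
case: (ltnP c (nth 0%N la r)) => [/box_ex[b <- <-]|le_c].
  by rewrite ev_to_rect ffunE.
by rewrite ev_to_rect_out // Tout // leqNgt Tin inshape_beta -leqNgt.
Qed.

Definition eq_below (T : filling n la) (b : box la) : bool :=
  [exists c, [&& brow c == (brow b).+1, bcol c == bcol b & T c == T b]].

Lemma eq_belowE T b :
  eq_below T b = (ev (to_rect T) (brow b).+1 (bcol b) == ev (to_rect T) (brow b) (bcol b)).
Proof.
rewrite ev_to_rect; apply/existsP/eqP => [[c /and3P[/eqP <- /eqP <- /eqP <-]]|E].
  exact: ev_to_rect.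
have : (ev (to_rect T) (brow b).+1 (bcol b) < n)%N by rewrite E.
rewrite ev_to_rect_lt => /box_ex[c Er Ec]; exists c; rewrite Er Ec !eqxx /=.
by rewrite -val_eqE /= -E -Er -Ec ev_to_rect.
Qed.

Lemma eq_below_countE T r :
  eq_below_count T r = #|[set b | (brow b == r) && eq_below T b]|.
Proof.
by apply: eq_card => b; rewrite !inE; case: eqP => //= <-.
Qed.

(* A column containing [i] is represented by its lowest box with entry [i].   *)
Lemma col_countE T i : is_rpp T ->
  col_count T i = #|[set b | (T b == i) && ~~ eq_below T b]|.
Proof.
move=> /andP[_ /forallP Tcol].
pose bcol' (b : box la) := Ordinal (bcol_lt_head b).
rewrite -(card_in_imset (f := bcol')).
  apply: eq_card => c; rewrite inE; apply/existsP/imsetP => [[b0 Pb0]|[b]]; last first.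
    by rewrite inE => /andP[Tb _] ->; exists b; rewrite Tb eqxx.
  case: (arg_maxnP (P := fun b => (bcol b == c) && (T b == i)) (fun b => brow b) Pb0)
    => b /andP[/eqP Ec Tb] b_max.
  exists b; last by apply: val_inj.
  rewrite inE Tb /=; apply/negP => /existsP[d /and3P[/eqP Er /eqP Ed /eqP Td]].
  by have := b_max d; rewrite Ed Ec Td Tb eqxx Er /= ltnn => /(_ isT).
(* Between two boxes of a column with entry [i] all entries are [i], so the upper one has an equal
   entry right below it. This gives uniqueness of the lowest box. *)
have lowest b c : (brow b < brow c)%N -> bcol b = bcol c -> T b = i -> T c = i -> eq_below T b.
  move=> lt_bc Ec Tb Tc.
  have lt_b : (bcol b < nth 0%N la (brow b).+1)%N.
    by rewrite Ec; apply: leq_trans (bcol_lt c) (part_leq lt_bc).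
  have [d Er Ed] := box_ex lt_b.
  apply/existsP; exists d; rewrite Er Ed !eqxx /= -val_eqE eqn_leq; apply/andP; split.
    rewrite Tb -Tc; have /forallP/(_ c)/implyP := Tcol d.
    by apply; rewrite Er Ed Ec eqxx.
  by have /forallP/(_ d)/implyP := Tcol b; apply; rewrite Er Ed eqxx leqnSn.
move=> b c; rewrite !inE => /andP[/eqP Tb /negP nb] /andP[/eqP Tc /negP nc] [Ec].
apply: box_inj => //; case: (ltngtP (brow b) (brow c)) => // lt_r.
  by case: nb; apply: (lowest b c).
by case: nc; apply: (lowest c b).
Qed.

Variables (R : comNzRingType) (x : n.-tuple R) (t : l.-1.-tuple R).

(** Both sides are a product over boxes: those with an equal entry below are grouped by row, the
    others by entry, via [col_countE]. *)
Lemma weight_to_rect T : is_rpp T ->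
  weight (nth 0 x) (nth 0 t) n (to_rect T)
    = (\prod_(r < l.-1) tnth t r ^+ eq_below_count T r) *
      (\prod_(i < n) tnth x i ^+ col_count T i).
Proof.
move=> Trpp.
transitivity (\prod_(b : box la) if eq_below T b then nth 0 t (brow b) else nth 0 x (T b)).
  pose G r c := if ev (to_rect T) r.+1 c == ev (to_rect T) r c then nth 0 t r
    else nth 0 x (ev (to_rect T) r c).
  rewrite /weight (eq_bigr (fun i : 'I_l => \prod_(j < nth 0%N la i) G i j)).
    rewrite sig_big_dep; apply: eq_bigr => b _.
    by rewrite eq_belowE; congr (if _ then _ else nth 0 x _); apply: ev_to_rect.
  move=> i _; rewrite (big_ord_widen _ (G i) (part_le_head i)).
  by apply: eq_bigl => j; rewrite ev_to_rect_lt.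
rewrite big_if /=; congr (_ * _).
  under [RHS]eq_bigr => r _.
    rewrite eq_below_countE -prodr_const.
    under eq_bigl => b do rewrite inE andbC.
    over.
  rewrite (exchange_big_dep (eq_below T)) /=; last by move=> r b _ /andP[].
  apply: eq_bigr => b bE.
  (* A box with an equal entry below is not in the last row, so the default 0 of [nth 0 t] is never
     met. *)
  have lt_b : (brow b < l.-1)%N.
    have /existsP[c /and3P[/eqP Er _ _]] := bE.
    by have := brow_lt c; rewrite Er; lia.
  rewrite (big_pred1 (Ordinal lt_b)) => [|r]; first by rewrite (tnth_nth 0).
  by rewrite bE /= -val_eqE eq_sym.
rewrite (partition_big T predT) //=; apply: eq_bigr => i _.
rewrite col_countE // -prodr_const; apply: eq_big => [b|b /andP[_ /eqP <-]].
  by rewrite inE andbC.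
by rewrite (tnth_nth 0).
Qed.

Lemma dual_groth_rect : dual_groth x t = rect_groth n (nth 0 x) (nth 0 t) n beta.
Proof.
rewrite /rect_groth (reindex_omap to_rect (fun T' => [pick T | to_rect T == T'])).
  rewrite /dual_groth; apply: eq_big => [T|T Trpp]; last by rewrite weight_to_rect.
  rewrite rect_rpp_to_rect; case: pickP => [T' /eqP /to_rect_inj ->|/(_ T)].
    by rewrite eqxx andbT.
  by rewrite eqxx.
move=> T' /to_rect_onto[T <-]; case: pickP => [T'' /eqP /= ->//|/(_ T)].
by rewrite eqxx.
Qed.

End BoxFillings.

(** * Identification with the multi-Schur determinant *)

Lemma sup_h_hshift (R : comNzRingType) (s : seq R) (m h k l : nat) :
  (h < l)%N -> (k < l)%N ->
  sup_h s [::] (m%:Z + h%:Z - k%:Z) = hshift s (l.-1 - h) (m + (l.-1 - k)).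
Proof.
(* The index m + h - k is the beta number m + (l - 1 - k) minus l - 1 - h; when negative, both sides
   are 0. *)
move=> lt_hl lt_kl; rewrite /hshift; case: leqP => le_hk.
  by rewrite (_ : m%:Z + _ - _ = (m + (l.-1 - k) - (l.-1 - h))%N); last by lia.
by case E: (_ - _)%R => [d|d] //=; lia.
Qed.

Lemma dual_groth_multi_schur (R : comNzRingType) (n : nat) (la : seq nat)
    (x : n.-tuple R) (t : (size la).-1.-tuple R) : sorted geq la ->
  dual_groth x t =
    multi_schur (fun k : 'I_(size la) => (nth 0%N la k)%:Z)
                (fun k => x ++ take k t) (fun=> [::]).
Proof.
move=> la_sorted.
rewrite (dual_groth_rect la_sorted) rect_groth_det ?strict_beta // /multi_schur.
congr (\det _); apply/matrixP => h k; rewrite !mxE ffunE /=.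
rewrite (sup_h_hshift _ _ (ltn_ord h) (ltn_ord k)); congr (hshift (_ ++ _) _ _).
  by rewrite -[X in mkseq _ X](size_tuple x) mkseq_nth.
have lt_kl := ltn_ord k.
have sz_take : size (take k t) = k by rewrite size_takel // size_tuple; lia.
apply: (@eq_from_nth _ 0) => [|i]; rewrite size_mkseq ?sz_take // => lt_ik.
by rewrite nth_mkseq // nth_take.
Qed.

Theorem corollary3p9 (K : comNzRingType) (n : nat) (la : seq nat)
    (hla : is_partition la) :
  let l := size la in
  let x : n.-tuple {mpoly K[n + l.-1]} :=
    [tuple 'X_(lshift l.-1 i) | i < n] in
  let t : l.-1.-tuple {mpoly K[n + l.-1]} :=
    [tuple 'X_(rshift n j) | j < l.-1] in
  dual_groth x t =
    multi_schur (fun k : 'I_l => (nth 0%N la k)%:Z)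
                (fun k : 'I_l => x ++ take k t)
                (fun k : 'I_l => [::]).
Proof. by move=> l x t; apply: dual_groth_multi_schur; have /andP[] := hla. Qed.
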